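(* Let $G$ be a directed forest, i.e. a Bayesian network on discrete random variables (with arbitrary positive numbers of levels) in which every node has at most one parent. Then the global Markov ideal $I_{\mathrm{global}(G)}\subset\mathbb{R}[D]$ is prime and has a quadratic Gröbner basis (for some term order, consisting of quadratic polynomials). These properties fail in general for the local Markov ideal: there exist directed forests $G$ (and numbers of levels) for which it is not true that $I_{\mathrm{local}(G)}$ is prime and has a quadratic Gröbner basis.
   Context: Independence ideals. Let $X_1,\dots,X_n$ be discrete random variables, $X_i$ taking values in $[d_i]=\{1,\dots,d_i\}$, and $D=[d_1]\times\cdots\times[d_n]$. $\mathbb{R}[D]$ is the polynomial ring over $\mathbb{R}$ in the unknowns $p_{u_1\cdots u_n}$, $(u_1,\dots,u_n)\in D$. For pairwise disjoint $A,B,C\subseteq\{X_1,\dots,X_n\}$ and tuples of values $a,b,c$ of the variables in $A,B,C$, let $p_{a,b,c,+}$ be the sum of all $p_u$ over $u\in D$ whose coordinates in $A,B,C$ are $a,b,c$. The ideal $I_{A\perp B\mid C}$ is generated by all $p_{a,b,c,+}\,p_{a',b',c,+}-p_{a,b',c,+}\,p_{a',b,c,+}$ (it is $0$ if $A$ or $B$ is empty). The ideal of a set of statements $A\perp B\mid C$ is the sum of the corresponding ideals. Bayesian networks. A Bayesian network is an acyclic directed graph $G$ with vertices $X_1,\dots,X_n$. Let $\mathrm{pa}(X_i)$ be the set of parents of $X_i$ and $\mathrm{nd}(X_i)$ the set of nondescendents of $X_i$, i.e. vertices $X_j\ne X_i$, not parents of $X_i$, such that there is no directed path from $X_i$ to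 $X_j$. Then $\mathrm{local}(G)=\{X_i\perp\mathrm{nd}(X_i)\mid\mathrm{pa}(X_i): i=1,\dots,n\}$. The set $\mathrm{global}(G)$ consists of all $A\perp B\mid C$ with $A,B,C$ pairwise disjoint vertex sets such that $A$ and $B$ are d-separated by $C$, meaning that every chain (path in the underlying undirected graph) from a vertex of $A$ to a vertex of $B$ is blocked by $C$. A chain $\pi$ is blocked by $C$ if it contains a vertex $X_b$ such that either $X_b\in C$ and the arrows of $\pi$ do not meet head-to-head at $X_b$, or $X_b\notin C$, $X_b$ has no descendents in $C$, and the arrows of $\pi$ do meet head-to-head at $X_b$. $I_{\mathrm{local}(G)}$ and $I_{\mathrm{global}(G)}$ are the ideals of $\mathrm{local}(G)$ and $\mathrm{global}(G)$. *)

(* Defs.v *)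
From mathcomp Require Import all_boot all_order all_algebra.
From mathcomp Require Import mpoly.
From mathcomp Require Import boolp classical_sets reals.

Set Implicit Arguments.
Unset Strict Implicit.
Unset Printing Implicit Defensive.

Import GRing.Theory.
Local Open Scope ring_scope.
Local Open Scope classical_set_scope.

Section Ideals.
Variable P : comNzRingType.

Definition ideal_gen (S : set P) : set P :=
  [set f | exists2 s : seq (P * P),
      (forall t, t \in s -> S t.2) & f = \sum_(t <- s) t.1 * t.2].

(* The library predicates are about boolean predicates, so the classical set
   [I] is coerced to one; [idealr_closed] includes [1 \notin I]. *)
Definition prime_ideal (I : set P) : Prop :=
  idealr_closed [pred f | f \in I] /\ prime_idealr_closed [pred f | f \in I].

End Ideals.

Section Groebner.
Variables (R : fieldType) (N : nat).
Implicit Types (le : rel 'X_{1..N}) (f : {mpoly R[N]}) (m : 'X_{1..N}).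

Definition term_order le : Prop :=
  [/\ total le, antisymmetric le, transitive le,
      (forall m, le 0%MM m)
    & forall m1 m2 m, le m1 m2 -> le (m1 + m)%MM (m2 + m)%MM].

(* Never holds for [f = 0]. *)
Definition leading_term le f m : Prop :=
  m \in msupp f /\ forall m', m' \in msupp f -> le m' m.

Definition initial_ideal le (S : set {mpoly R[N]}) : set {mpoly R[N]} :=
  ideal_gen [set g | exists f m, [/\ S f, leading_term le f m & g = 'X_[m]]].

Definition groebner_basis le (I : set {mpoly R[N]}) (B : seq {mpoly R[N]}) :=
  (forall g, g \in B -> I g) /\
  initial_ideal le I = initial_ideal le [set g | g \in B].

(* [msize g] is the total degree of [g] plus one when [g != 0]. *)
Definition has_quadratic_groebner_basis (I : set {mpoly R[N]}) : Prop :=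
  exists le B, [/\ term_order le, groebner_basis le I B
    & forall g, g \in B -> msize g = 3%N].

End Groebner.

Section Statements.
Variable n : nat.

(* [Indep A B C] stands for the independence statement A _||_ B | C. *)
Record indep_statement := Indep {
  indep_left : {set 'I_n};
  indep_right : {set 'I_n};
  indep_given : {set 'I_n} }.

End Statements.

Section IndependenceIdeals.
Variables (R : realType) (n : nat) (d : 'I_n -> nat).

Definition states := {dffun forall i : 'I_n, 'I_(d i)}.

Definition values (A : {set 'I_n}) :=
  {dffun forall i : {i : 'I_n | i \in A}, 'I_(d (val i))}.

Definition agrees (A : {set 'I_n}) (u : states) (a : values A) : bool :=
  [forall i : {i : 'I_n | i \in A}, u (val i) == a i].

Definition unknown (u : states) : {mpoly R[#|states|]} := 'X_(enum_rank u).

Definition marginal (A B C : {set 'I_n})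
    (a : values A) (b : values B) (c : values C) : {mpoly R[#|states|]} :=
  \sum_(u : states | [&& agrees u a, agrees u b & agrees u c]) unknown u.

(* If [A] or [B] is empty it has a single tuple of values, and the generators
   below all vanish. *)
Definition indep_ideal (s : indep_statement n) : set {mpoly R[#|states|]} :=
  let: Indep A B C := s in
  ideal_gen [set f | exists (a a' : values A) (b b' : values B) (c : values C),
    f = marginal a b c * marginal a' b' c - marginal a b' c * marginal a' b c].

Definition statements_ideal (S : set (indep_statement n)) :
    set {mpoly R[#|states|]} :=
  ideal_gen [set f | exists2 s, S s & indep_ideal s f].

End IndependenceIdeals.

Arguments statements_ideal R {n} d S _.

(* A directed graph is its edge relation: [e i j] means that there is an edge
   from [i] to [j]. *)
Section Networks.
Variables (n : nat) (e : rel 'I_n).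
Implicit Types (A B C : {set 'I_n}) (p : seq 'I_n).

(* The case [i = j] excludes loops. *)
Definition acyclic : Prop := forall i j, e i j -> ~~ connect e j i.

Definition pa (i : 'I_n) : {set 'I_n} := [set j | e j i]%SET.

Definition nd (i : 'I_n) : {set 'I_n} :=
  [set j | [&& j != i, j \notin pa i & ~~ connect e i j]]%SET.

Definition directed_forest : Prop :=
  acyclic /\ forall i, (#|pa i| <= 1)%N.

Definition local_statements : set (indep_statement n) :=
  [set s | exists i, s = Indep [set i]%SET (nd i) (pa i)].

Definition chain p : bool :=
  uniq p && sorted (fun i j => e i j || e j i) p.

Definition head_to_head p (x : 'I_n) : bool :=
  [exists y, exists z, [&& infix [:: y; x; z] p, e y x & e z x]].

(* [connect] is reflexive, which is harmless for the descendents of [x] since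
   [x \notin C]. *)
Definition blocked C p : Prop :=
  exists2 x, x \in p &
    (x \in C /\ ~~ head_to_head p x) \/
    [/\ x \notin C, (forall y, y \in C -> ~~ connect e x y)
      & head_to_head p x].

Definition d_separated A B C : Prop :=
  forall x p, x \in A -> last x p \in B -> chain (x :: p) -> blocked C (x :: p).

Definition global_statements : set (indep_statement n) :=
  [set s | let: Indep A B C := s in
     [/\ [disjoint A & B]%B, [disjoint A & C]%B, [disjoint B & C]%B
       & d_separated A B C]].

End Networks.

Definition I_local (R : realType) n (d : 'I_n -> nat) (e : rel 'I_n) :=
  statements_ideal R d (local_statements e).

Definition I_global (R : realType) n (d : 'I_n -> nat) (e : rel 'I_n) :=
  statements_ideal R d (global_statements e).

Arguments I_local R {n} d e _.
Arguments I_global R {n} d e _.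

(* Main.v *)
From HB Require Import structures.
Require Import Defs.
From mathcomp Require Import all_boot all_order all_algebra.
From mathcomp Require Import mpoly.
From mathcomp Require Import boolp classical_sets reals.
From mathcomp Require Import zify ring lra.

(** In a directed forest no vertex has two parents, so no chain contains a
    collider and d-separation is plain separation in the underlying undirected
    forest.  Hence two states [u] and [v] that agree on the separating set [C]
    may exchange their coordinates on one side of [C], and such an exchange does
    not change how often each value of a pair (vertex, parent) occurs.  This
    says that the global ideal is contained in the kernel of the monomial map
    [toric_map] that records these numbers of occurrences.

    The converse inclusion and the Groebner basis come together.  List the
    vertices in topological order and read a state as a number [N(u)] written in
    a fixed base, earlier vertices being more significant.  Suppose that [u] and
    [v] agree on the parent of [k], that [u] precedes [v] on the vertices before
    [k], and that [u k < v k].  Exchanging the coordinates on the descendents of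
    [k] keeps [N(u) + N(v)] and moves both numbers strictly inside the interval
    from [N(u)] to [N(v)], so it lowers the sum of the squares
    ([moves_lower_weight]).  The binomials of these exchanges are quadratic, they
    lie in the global ideal, since the descendents of [k] are separated from the
    other vertices by the parent of [k] ([move_global]), and for the order by
    the weight [N(u)^2] their leading monomials are the pairs that admit an
    exchange.

    A monomial that admits no exchange is, at each vertex [k] and for each value
    of the parent, a multiset of states in which the value at [k] weakly
    decreases along the earlier coordinates.  Such an arrangement is determined
    by its two marginals ([antisorted_unique]), so by induction along the
    topological order the monomial is determined by its image under the toric
    map ([irreducible_moves_inj]).  A general criterion ([toric_prime],
    [toric_groebner]) then shows that the ideal is the whole kernel, which is
    prime because the target is a domain, and that the exchange binomials form a
    Groebner basis.

    For the negative part, take the chain [0 -> 1 -> 2 -> 3] with one level at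
    vertex 1 and two levels elsewhere.  Its local ideal contains a product of
    three polynomials ([chain4_identity]), and evaluation at two points of its
    zero set shows that it contains none of the factors. *)

Set Implicit Arguments.
Unset Strict Implicit.
Unset Printing Implicit Defensive.

Import Order.TTheory GRing.Theory Num.Theory.
Local Open Scope ring_scope.

(** * Generated ideals *)

Section GeneratedIdeals.
Variable P : comNzRingType.
Implicit Types (S : set P) (f g : P).

Lemma ideal_gen0 S : ideal_gen S 0.
Proof. by exists [::]; rewrite ?big_nil. Qed.

Lemma ideal_genD S f g : ideal_gen S f -> ideal_gen S g -> ideal_gen S (f + g).
Proof.
move=> [s sS ->] [t tS ->]; exists (s ++ t); last by rewrite big_cat.
by move=> x; rewrite mem_cat => /orP[/sS|/tS].
Qed.

Lemma ideal_genMl S f g : ideal_gen S g -> ideal_gen S (f * g).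
Proof.
move=> [s sS ->]; exists [seq (f * t.1, t.2) | t <- s].
  by move=> x /mapP[t /sS St ->].
by rewrite big_map mulr_sumr; apply: eq_bigr => t _; rewrite mulrA.
Qed.

Lemma ideal_gen_sum S (I : Type) (r : seq I) (Q : pred I) (F : I -> P) :
  (forall i, Q i -> ideal_gen S (F i)) -> ideal_gen S (\sum_(i <- r | Q i) F i).
Proof.
move=> SF; elim/big_rec: _ => [|i x Qi]; first exact: ideal_gen0.
exact/ideal_genD/SF.
Qed.

Lemma sub_ideal_gen S f : S f -> ideal_gen S f.
Proof.
move=> Sf; exists [:: (1, f)]; last by rewrite big_seq1 mul1r.
by move=> t; rewrite inE => /eqP->.
Qed.

Lemma ideal_gen_le S1 S2 :
  (forall f, S1 f -> ideal_gen S2 f) -> forall f, ideal_gen S1 f -> ideal_gen S2 f.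
Proof.
move=> S12 f [s sS ->]; rewrite big_seq; apply: ideal_gen_sum => t /sS St.
exact/ideal_genMl/S12.
Qed.

Lemma ideal_gen_rmorph0 S (Q : nzRingType) (phi : {rmorphism P -> Q}) :
  (forall f, S f -> phi f = 0) -> forall f, ideal_gen S f -> phi f = 0.
Proof.
move=> S0 f [s sS ->]; rewrite rmorph_sum big_seq big1 // => t /sS /S0 t0.
by rewrite rmorphM t0 mulr0.
Qed.

End GeneratedIdeals.

(** * Toric maps *)

Section Toric.
Variables (R : realType) (N M : nat) (S : 'I_N -> 'X_{1..M}).
Implicit Types (m : 'X_{1..N}) (f g : {mpoly R[N]}).

Definition mnm_image m : 'X_{1..M} := (\sum_i S i *+ m i)%MM.

Definition toric_map : {mpoly R[N]} -> {mpoly R[M]} :=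
  mmap (@mpolyC M R) (fun i => 'X_[S i]).

HB.instance Definition _ := GRing.RMorphism.on toric_map.

Lemma mnm_imageD m1 m2 :
  mnm_image (m1 + m2)%MM = (mnm_image m1 + mnm_image m2)%MM.
Proof.
apply/mnmP => j; rewrite mnmDE !mnm_sumE -big_split; apply: eq_bigr => i _.
by rewrite !mulmnE mnmDE mulnDr.
Qed.

Lemma mnm_image1 i : mnm_image U_(i)%MM = S i.
Proof.
apply/mnmP => j; rewrite mnm_sumE (bigD1 i) //= big1 => [|k ki].
  by rewrite mulmnE mnm1E eqxx muln1 addn0.
by rewrite mulmnE mnm1E eq_sym (negbTE ki) muln0.
Qed.

Lemma toric_mapX m : toric_map 'X_[m] = 'X_[mnm_image m].
Proof. by rewrite /toric_map mmapX /mmap1 mprodXnE. Qed.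

Lemma mcoeff_toric_map f s :
  (toric_map f)@_s = \sum_(m <- msupp f | mnm_image m == s) f@_m.
Proof.
rewrite {1}(mpolyE f) rmorph_sum raddf_sum [RHS]big_mkcond /=.
apply: eq_bigr => m _.
rewrite [toric_map _]mmapZ [mmap _ _ _]toric_mapX mcoeffCM mcoeffX.
by case: eqP; rewrite ?mulr1 ?mulr0.
Qed.

End Toric.

(** * Term orders refining a weight *)

Section WeightOrder.
Variables (N : nat) (W : 'I_N -> nat).
Implicit Types m : 'X_{1..N}.

Definition mnm_weight m : nat := (\sum_i m i * W i)%N.

(** Ties are broken by the graded lexicographic order, which makes the order
    total whatever the weight is. *)
Definition weight_le : rel 'X_{1..N} := fun m1 m2 =>
  (mnm_weight m1 < mnm_weight m2)%N ||
  (mnm_weight m1 == mnm_weight m2) && (m1 <= m2)%O.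

Lemma mnm_weightD m1 m2 :
  mnm_weight (m1 + m2)%MM = (mnm_weight m1 + mnm_weight m2)%N.
Proof.
by rewrite /mnm_weight -big_split; apply: eq_bigr => i _; rewrite mnmDE mulnDl.
Qed.

Lemma mnm_weight1 i : mnm_weight U_(i)%MM = W i.
Proof.
rewrite /mnm_weight (bigD1 i) //= big1 => [|j ji].
  by rewrite mnm1E eqxx mul1n addn0.
by rewrite mnm1E eq_sym (negbTE ji).
Qed.

Lemma weight_le_term_order : term_order weight_le.
Proof.
split.
- move=> m1 m2; rewrite /weight_le.
  by case: ltngtP => //= _; apply: le_total.
- move=> m1 m2; rewrite /weight_le.
  by case: ltngtP => //= _; apply: le_anti.
- move=> m2 m1 m3; rewrite /weight_le.
  case: (ltngtP (mnm_weight m1)) => //= [lt12 _|->].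
    by case: ltngtP => //= [lt23|<-]; rewrite ?lt12 // (ltn_trans lt12 lt23).
  by case: ltngtP => //= _; apply: le_trans.
- move=> m; rewrite /weight_le le0m andbT orbC -leq_eqVlt.
  by rewrite /mnm_weight big1 // => i _; rewrite mnm0E.
- move=> m1 m2 m; rewrite /weight_le !mnm_weightD ltn_add2r eqn_add2r.
  by rewrite lemc_add2l.
Qed.

End WeightOrder.

(** * A Groebner criterion for toric ideals *)

Section ToricGroebner.
Variables (R : realType) (N M : nat) (S : 'I_N -> 'X_{1..M}) (W : 'I_N -> nat).
Variables (Gen : set {mpoly R[N]}) (moves : seq ('I_N * 'I_N * ('I_N * 'I_N))).
Implicit Types (m : 'X_{1..N}) (f g : {mpoly R[N]}).

Definition pair_mnm (x : 'I_N * 'I_N) : 'X_{1..N} := (U_(x.1) + U_(x.2))%MM.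

(** A move replaces the pair of unknowns [x.1] by the pair [x.2]. *)
Definition move_binomial (x : 'I_N * 'I_N * ('I_N * 'I_N)) : {mpoly R[N]} :=
  'X_[pair_mnm x.1] - 'X_[pair_mnm x.2].

Definition irreducible m :=
  forall x, x \in moves -> ~~ (pair_mnm x.1 <= m)%MM.

Hypothesis Gen_kernel : forall f, Gen f -> toric_map S f = 0.
Hypothesis moves_gen : forall x, x \in moves -> ideal_gen Gen (move_binomial x).
Hypothesis moves_decrease : forall x, x \in moves ->
  (mnm_weight W (pair_mnm x.2) < mnm_weight W (pair_mnm x.1))%N.
Hypothesis irreducible_inj : forall m1 m2, irreducible m1 -> irreducible m2 ->
  mnm_image S m1 = mnm_image S m2 -> m1 = m2.

Let le := weight_le W.

Lemma toric_map_ideal f : ideal_gen Gen f -> toric_map S f = 0.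
Proof. exact: (ideal_gen_rmorph0 (phi := toric_map S)). Qed.

Lemma move_image x : x \in moves ->
  mnm_image S (pair_mnm x.1) = mnm_image S (pair_mnm x.2).
Proof.
move=> /moves_gen /toric_map_ideal; rewrite rmorphB /= !toric_mapX.
move/eqP; rewrite subr_eq0 => /eqP /(congr1 (mcoeff (mnm_image S (pair_mnm x.2)))).
rewrite !mcoeffX eqxx; case: eqP => // _ /eqP.
by rewrite eq_sym oner_eq0.
Qed.

(** Since each move strictly lowers the weight, rewriting by moves stops.  The
    last clause makes a normal form different from [m] smaller than [m]; the
    comparison of leading terms rests on it. *)
Lemma normal_form m : exists m0, [/\ irreducible m0,
  mnm_image S m0 = mnm_image S m, ideal_gen Gen ('X_[m] - 'X_[m0])
  & m0 = m \/ (mnm_weight W m0 < mnm_weight W m)%N].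
Proof.
elim/ltn_ind: {m}(mnm_weight W m) {-2}m (erefl (mnm_weight W m)) => w IH m mw.
have [[x [xm le_m]]|irr] :=
    pselect (exists x, x \in moves /\ (pair_mnm x.1 <= m)%MM); last first.
  exists m; split; [|by []|by rewrite subrr; apply: ideal_gen0|by left].
  by move=> x xm; apply/negP => le_m; apply: irr; exists x.
pose r := (m - pair_mnm x.1)%MM; have m_def : m = (r + pair_mnm x.1)%MM.
  by rewrite submK.
pose m' := (r + pair_mnm x.2)%MM.
have lt_w : (mnm_weight W m' < w)%N.
  by rewrite -mw m_def !(mnm_weightD _ r) ltn_add2l moves_decrease.
have [m0 [irr im gen w0]] := IH _ lt_w m' (erefl _).
exists m0; split => //.
- by rewrite im m_def !(mnm_imageD _ r) (move_image xm).
- rewrite -(subrKA 'X_[m']); apply: ideal_genD => //.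
  by rewrite m_def !(mpolyXD _ r) -mulrBr; apply/ideal_genMl/moves_gen.
- by right; rewrite mw; case: w0 => [->//|/ltn_trans]; apply.
Qed.

(** Modulo the ideal each monomial can be replaced by its normal form.  As
    irreducible monomials with the same image coincide, the coefficients of the
    resulting polynomial are coefficients of the image of [f]. *)
Lemma kernel_ideal f : toric_map S f = 0 -> ideal_gen Gen f.
Proof.
move=> f0; have [nf nfP] := choice normal_form.
(* The sum of the terms [f@_m *: 'X_[nf m]] vanishes. *)
have -> : f = \sum_(m <- msupp f) f@_m *: ('X_[m] - 'X_[nf m]).
  under eq_bigr do rewrite scalerBr.
  rewrite sumrB -mpolyE; apply/eqP; rewrite -subr_eq0 opprB addrC subrK.
  apply/eqP/mpolyP => s; rewrite mcoeff0 raddf_sum /=.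
  under eq_bigr do rewrite mcoeffZ mcoeffX.
  have [irr|red] := pselect (irreducible s); last first.
    rewrite big1 // => m _; case: eqP => [nfs|]; last by rewrite mulr0.
    by case: red; rewrite -nfs; case: (nfP m).
  transitivity ((toric_map S f)@_(mnm_image S s)); last by rewrite f0 mcoeff0.
  rewrite mcoeff_toric_map [RHS]big_mkcond /=; apply: eq_bigr => m _.
  have [irm im _ _] := nfP m; rewrite -im.
  case: eqP => [->|nfs]; first by rewrite eqxx mulr1.
  by rewrite mulr0; case: eqP => // /(irreducible_inj irm irr).
apply: ideal_gen_sum => m _; rewrite -mul_mpolyC; apply: ideal_genMl.
by case: (nfP m).
Qed.

Lemma toric_prime : prime_ideal (ideal_gen Gen).
Proof.
have memE f : (f \in [pred f | f \in ideal_gen Gen]) = (toric_map S f == 0).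
  rewrite inE; apply/idP/eqP; first by move/set_mem/toric_map_ideal.
  by move/kernel_ideal/mem_set.
split.
  split; rewrite ?memE ?rmorph0 ?eqxx ?rmorph1 ?oner_eq0 //.
  move=> a f g; rewrite !memE rmorphD rmorphM /= => /eqP-> /eqP->.
  by rewrite mulr0 addr0.
by move=> f g; rewrite !memE rmorphM mulf_eq0.
Qed.

(** The coefficients of [f] on the fiber of [m] add up to zero, so another
    monomial [m'] of [f] lies in this fiber.  Were [m] irreducible, it would be
    the normal form of [m'], hence smaller than [m']. *)
Lemma leading_reducible f m : toric_map S f = 0 -> leading_term le f m ->
  exists2 x, x \in moves & (pair_mnm x.1 <= m)%MM.
Proof.
move=> f0 [mf le_m]; apply: contrapT => no_move.
have irr : irreducible m.
  by move=> x xm; apply/negP => lxm; apply: no_move; exists x.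
have : (toric_map S f)@_(mnm_image S m) = 0 by rewrite f0 mcoeff0.
rewrite mcoeff_toric_map big_mkcond (bigD1_seq m) ?msupp_uniq //= eqxx.
rewrite big_seq_cond big1 ?addr0; first by apply/eqP; rewrite -mcoeff_msupp.
move=> m' /andP[m'f m'm]; case: eqP => // im; case/negP: m'm; apply/eqP.
have [m0 [irr0 im0 _ w0]] := normal_form m'.
have m0m : m0 = m by apply: irreducible_inj => //; rewrite im0.
move: w0 (le_m _ m'f); rewrite m0m => -[//|].
by rewrite /le /weight_le; case: ltngtP.
Qed.

Lemma move_leading x : x \in moves ->
  leading_term le (move_binomial x) (pair_mnm x.1).
Proof.
move=> xm; have lt_w := moves_decrease xm; split.
  rewrite mcoeff_msupp mcoeffB !mcoeffX eqxx.
  case: (pair_mnm x.2 =P _) => [eqx|_]; last by rewrite subr0 oner_eq0.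
  by rewrite eqx ltnn in lt_w.
move=> m' /msuppB_le; rewrite !msuppX !inE => /orP[]/eqP->.
  by rewrite /le /weight_le eqxx lexx orbT.
by rewrite /le /weight_le lt_w.
Qed.

Lemma move_msize x : x \in moves -> msize (move_binomial x) = 3%N.
Proof.
move=> xm; apply/eqP; rewrite eqn_leq; apply/andP; split.
  apply: leq_trans (msizeD_le _ _) _.
  by rewrite msizeN !msizeX !mdegD !mdeg1.
have [/msize_mdeg_lt] := move_leading xm.
by rewrite mdegD !mdeg1.
Qed.

Lemma toric_groebner : has_quadratic_groebner_basis (ideal_gen Gen).
Proof.
exists le, [seq move_binomial x | x <- moves]; split.
- exact: weight_le_term_order.
- split=> [g /mapP[x xm ->]|]; first exact: moves_gen.
  apply/seteqP; split; apply: ideal_gen_le => g [f [m [fI fm ->]]].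
    have [x xm le_xm] := leading_reducible (toric_map_ideal fI) fm.
    rewrite -(submK le_xm) mpolyXD; apply/ideal_genMl/sub_ideal_gen.
    exists (move_binomial x), (pair_mnm x.1); split => //.
      exact: map_f.
    exact: move_leading.
  apply: sub_ideal_gen; exists f, m; split => //.
  by case/mapP: fI => x xm ->; apply: moves_gen.
- by move=> g /mapP[x xm ->]; apply: move_msize.
Qed.

End ToricGroebner.

(** * Positional codes *)

Section Code.
Variables (I : eqType) (b : nat).
Implicit Types (s : seq I) (x y : I -> nat).
Local Open Scope nat_scope.

(** The number with digits [x] along [s] in base [b], the first entry of [s]
    being the most significant one. *)
Definition code s x : nat := foldl (fun c i => c * b + x i) 0 s.

Lemma code_rcons s i x : code (rcons s i) x = code s x * b + x i.
Proof. by rewrite /code foldl_rcons. Qed.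

Lemma eq_code s x y : {in s, x =1 y} -> code s x = code s y.
Proof.
elim/last_ind: s => // s i IH xy; rewrite !code_rcons xy ?mem_rcons ?mem_head //.
by rewrite IH // => j js; apply: xy; rewrite mem_rcons inE js orbT.
Qed.

Lemma ltn_code_cat s1 s2 x y : (forall i, x i < b) ->
  code s1 x < code s1 y -> code (s1 ++ s2) x < code (s1 ++ s2) y.
Proof.
move=> xb; elim/last_ind: s2 => [|s2 i IH]; first by rewrite cats0.
move=> /IH lt_xy; rewrite -rcons_cat !code_rcons.
have := xb i; nia.
Qed.

Lemma code_rcons_eq s i x y : x i < b -> y i < b ->
  (code (rcons s i) x == code (rcons s i) y) =
  (code s x == code s y) && (x i == y i).
Proof.
move=> xb yb; rewrite !code_rcons; apply/eqP/andP => [|[/eqP-> /eqP->]] //.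
move=> E; have : code s x = code s y by nia.
by move=> E1; move: E; rewrite E1 => /addnI ->.
Qed.

Lemma code_inj s x y : (forall i, x i < b) -> (forall i, y i < b) ->
  code s x = code s y -> {in s, x =1 y}.
Proof.
move=> xb yb; elim/last_ind: s => // s i IH /eqP.
rewrite code_rcons_eq // => /andP[/eqP /IH{}IH /eqP xyi] j.
by rewrite mem_rcons inE => /orP[/eqP->|/IH].
Qed.

(** The code is linear in the digits, so exchanging digits between two
    numbers keeps their sum. *)
Lemma code_addn s x y x' y' : (forall i, x i + y i = x' i + y' i) ->
  code s x + code s y = code s x' + code s y'.
Proof.
move=> E; elim/last_ind: s => // s i IH; rewrite !code_rcons.
have := E i; nia.
Qed.

End Code.

(** * Antisorted multisets *)

Section Mass.
Variable T : finType.
Variables (key val : T -> nat).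
Implicit Types (mu nu : T -> nat) (P Q : pred T).
Local Open Scope nat_scope.

Definition mass mu P : nat := \sum_(u | P u) mu u.

Lemma eq_mass mu P Q : P =1 Q -> mass mu P = mass mu Q.
Proof. exact: eq_bigl. Qed.

Lemma mass_split mu P Q :
  mass mu P = mass mu (fun u => P u && Q u) + mass mu (fun u => P u && ~~ Q u).
Proof. exact: bigID. Qed.

Lemma leq_mass mu P Q : (forall u, P u -> Q u) -> mass mu P <= mass mu Q.
Proof.
move=> PQ; rewrite (mass_split mu Q P) (@eq_mass _ (fun u => Q u && P u) P) ?leq_addr //.
by move=> u; apply/andb_idl/PQ.
Qed.

Lemma mass_eq0 mu P : (forall u, P u -> mu u = 0) -> mass mu P = 0.
Proof. exact: big1. Qed.

(** A mass over the preimage of a set is a sum of masses of fibers.  The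
    fibers are indexed by points of [T] because [Y] need not be finite. *)
Lemma mass_fiber (Y : eqType) (f : T -> Y) (Q : pred Y) mu nu :
  (forall v, mass mu (fun u => f u == f v) = mass nu (fun u => f u == f v)) ->
  mass mu (fun u => Q (f u)) = mass nu (fun u => Q (f u)).
Proof.
suff E m : mass m (fun u => Q (f u)) =
    \sum_(y <- undup (codom f) | Q y) mass m (fun u => f u == y).
  move=> fib; rewrite (E mu) (E nu) big_seq_cond [RHS]big_seq_cond; apply: eq_bigr => y.
  by rewrite mem_undup => /andP[/codomP[v ->] _].
rewrite /mass; under [RHS]eq_bigr do rewrite big_mkcond.
rewrite exchange_big big_mkcond; apply: eq_bigr => u _ /=.
rewrite big_mkcond (bigD1_seq (f u)) ?undup_uniq ?mem_undup ?codom_f //= eqxx.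
rewrite big1_seq ?addn0 // => y /andP[yu _].
by rewrite eq_sym (negbTE yu) if_same.
Qed.

Definition antisorted mu P := forall u v, 0 < mu u -> 0 < mu v ->
  P u -> P v -> key u < key v -> val v <= val u.

(** If a point with [key] below [x] had value below [t] and a point with [key]
    at least [x] had value at least [t], the two would be in the wrong order.
    So one of these two regions is empty, and the mass of the corner
    is the smaller one of the two masses that contain it. *)
Lemma mass_antisorted mu P x t : antisorted mu P ->
  mass mu (fun u => [&& P u, key u < x & t <= val u]) =
  minn (mass mu (fun u => P u && (key u < x)))
       (mass mu (fun u => P u && (t <= val u))).
Proof.
move=> anti.
set L := mass mu _; set K := mass mu _; set V := mass mu _.
have LK : L <= K by apply: leq_mass => u /and3P[-> -> _].
have LV : L <= V by apply: leq_mass => u /and3P[-> _ ->].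
have [[u /and4P[mu0 Pu ux ut]]|noneL] :=
    pselect (exists u, [&& 0 < mu u, P u, key u < x & val u < t]).
  suff : L = V by lia.
  rewrite /V (mass_split _ _ (fun u => key u < x)) [X in _ = _ + X]mass_eq0.
    by rewrite addn0; apply: eq_mass => v; rewrite -andbA [(_ < _) && _]andbC.
  move=> v /andP[/andP[Pv vt]]; rewrite -leqNgt => vx.
  apply/eqP; rewrite -leqn0 leqNgt; apply/negP => mv0.
  have := anti _ _ mu0 mv0 Pu Pv (leq_trans ux vx); lia.
suff : L = K by lia.
rewrite /K (mass_split _ _ (fun u => t <= val u)) [X in _ = _ + X]mass_eq0.
  by rewrite addn0; apply: eq_mass => v; rewrite -andbA.
move=> v /andP[/andP[Pv vx]]; rewrite -ltnNge => vt.
apply/eqP; rewrite -leqn0 leqNgt; apply/negP => mv0.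
by apply: noneL; exists v; rewrite mv0 Pv vx.
Qed.

(** The analogue of the uniqueness of the antitone coupling: by
    [mass_antisorted] the distribution function of the pair ([key], [val]) in
    each class is a function of the two marginals, and differences of
    the distribution function give the mass of each point. *)
Lemma antisorted_unique (Y : eqType) (cls : T -> Y) mu nu :
  (forall u v, key u = key v -> cls u = cls v) ->
  (forall c, antisorted mu (fun u => cls u == c)) ->
  (forall c, antisorted nu (fun u => cls u == c)) ->
  (forall v, mass mu (fun u => key u == key v) =
             mass nu (fun u => key u == key v)) ->
  (forall v, mass mu (fun u => (cls u, val u) == (cls v, val v)) =
             mass nu (fun u => (cls u, val u) == (cls v, val v))) ->
  forall v, mass mu (fun u => (key u == key v) && (val u == val v)) =
            mass nu (fun u => (key u == key v) && (val u == val v)).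
Proof.
move=> key_cls mu_anti nu_anti Ekey Eval v; pose c := cls v.
pose box x t u := [&& cls u == c, key u < x & t <= val u].
have Ebox x t : mass mu (box x t) = mass nu (box x t).
  rewrite !mass_antisorted //; congr minn.
    pose Q y := [exists w, (key w == y) && (cls w == c)] && (y < x).
    have QE : (fun u => (cls u == c) && (key u < x)) =1 (fun u => Q (key u)).
      move=> u; congr (_ && _).
      apply/idP/existsP => [uc|]; first by exists u; rewrite eqxx.
      by case=> w /andP[/eqP/key_cls <-].
    by rewrite !(eq_mass _ QE); apply: mass_fiber.
  exact: (mass_fiber (fun y => (y.1 == c) && (t <= y.2)) Eval).
pose col t u := [&& cls u == c, key u == key v & t <= val u].
have Ecol t : mass mu (col t) = mass nu (col t).
  have box_split m : mass m (box (key v).+1 t) =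
      mass m (box (key v) t) + mass m (col t).
    rewrite (mass_split m _ (fun u => key u < key v)).
    by congr (_ + _); apply: eq_mass => u; rewrite /box /col; lia.
  by have := Ebox (key v).+1 t; rewrite !box_split Ebox => /addnI.
have col_split m : mass m (col (val v)) = mass m (col (val v).+1) +
    mass m (fun u => (key u == key v) && (val u == val v)).
  rewrite (mass_split m _ (fun u => val v < val u)).
  congr (_ + _); apply: eq_mass => u; rewrite /col; first by lia.
  apply/idP/andP => [|[/eqP ku /eqP vu]]; first by lia.
  by rewrite /c (key_cls _ _ ku) ku vu !eqxx leqnn ltnn.
by have := Ecol (val v); rewrite !col_split Ecol => /addnI.
Qed.

End Mass.

(** * Separation in directed forests *)

Section Forest.
Variables (n : nat) (e : rel 'I_n).
Hypothesis forest : directed_forest e.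
Implicit Types (i j k : 'I_n) (A B C D : {set 'I_n}).

Definition descendents k : {set 'I_n} := [set j | connect e k j]%SET.

Lemma in_pa i j : (i \in pa e j) = e i j.
Proof. by rewrite inE. Qed.

Lemma parent_uniq i j k : e i k -> e j k -> i = j.
Proof.
have [_ /(_ k) /card_le1_eqP] := forest.
by move=> + ik jk; apply; rewrite inE.
Qed.

Lemma forest_no_collider p i : uniq p -> ~~ head_to_head e p i.
Proof.
move=> up; apply/existsP => -[j /existsP[k /and3P[jik ji ki]]].
by have := infix_uniq jik up; rewrite (parent_uniq ji ki) /= !inE eqxx orbT.
Qed.

Lemma parentN_descendent j k : e j k -> ~~ connect e k j.
Proof. by case: forest => + _; apply. Qed.

(** An edge that enters the descendents of [k] from outside ends at [k]: any
    other descendent has its only parent among the descendents. *)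
Lemma leave_descendents k i j : i \in descendents k -> j \notin descendents k ->
  e i j || e j i -> j \in pa e k.
Proof.
rewrite !inE => ki kj /orP[ij|ji].
  by rewrite (connect_trans ki (connect1 ij)) in kj.
case/connectP: ki => p; case/lastP: p => [_ /= <-//|p w].
rewrite rcons_path last_rcons => /andP[kp wi] iw; subst w.
rewrite (parent_uniq ji wi) in kj; case/negP: kj.
by apply/connectP; exists p.
Qed.

Lemma chain_leave_descendents k i p : path (fun i j => e i j || e j i) i p ->
  i \in descendents k -> last i p \notin descendents k ->
  exists2 j, j \in i :: p & j \in pa e k.
Proof.
elim: p i => [|j p IH] i /=; first by move=> _ ->.
move=> /andP[ij jp] ik lk; have [jk|jk] := boolP (j \in descendents k).
  have [w wp wk] := IH j jp jk lk; exists w => //.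
  by rewrite inE wp orbT.
exists j; first by rewrite !inE eqxx orbT.
exact: leave_descendents ij.
Qed.

Lemma descendents_separated k :
  global_statements e (Indep (descendents k) (nd e k) (pa e k)).
Proof.
split.
- rewrite disjoint_subset; apply/fintype.subsetP => j; rewrite !inE => ->.
  by rewrite !andbF.
- rewrite disjoint_subset; apply/fintype.subsetP => j; rewrite !inE => kj.
  by apply/negP => /parentN_descendent; rewrite kj.
- by rewrite disjoint_subset; apply/fintype.subsetP => j; rewrite !inE => /and3P[].
- move=> i p ik; rewrite inE => /and3P[_ _ lk] /andP[up ch].
  have [|j jp jk] := chain_leave_descendents ch ik; first by rewrite inE.
  by exists j => //; left; split => //; apply: forest_no_collider.
Qed.

Lemma descendents_cover k : (descendents k :|: nd e k :|: pa e k = [set: 'I_n])%SET.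
Proof.
apply/setP => j; rewrite !inE; case: eqVneq => [->|_]; first by rewrite connect0.
by case: (connect e k j) => //=; case: (e j k).
Qed.

End Forest.

(** * Topological order *)

Section TopologicalOrder.
Variables (n : nat) (e : rel 'I_n).
Hypothesis forest : directed_forest e.
Implicit Types (i j k : 'I_n) (A B C D : {set 'I_n}).

Definition ancestors k : {set 'I_n} := [set j | connect e j k]%SET.

(** The number of ancestors increases strictly along edges, so sorting by it
    gives a topological order. *)
Lemma ancestors_lt j k : connect e j k -> j != k ->
  (#|ancestors j| < #|ancestors k|)%N.
Proof.
move=> jk j_k; apply: proper_card; apply/properP; split.
  by apply/fintype.subsetP => i; rewrite !inE => /connect_trans; apply.
exists k; rewrite !inE //; apply/negP => kj.
case/connectP: jk => -[_ /= E|w p /= /andP[jw wp] lk].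
  by rewrite E eqxx in j_k.
have := parentN_descendent forest jw; rewrite (@connect_trans _ _ k) //.
by apply/connectP; exists p.
Qed.

Definition topo : seq 'I_n :=
  sort (relpre (fun k => #|ancestors k|) leq) (enum 'I_n).

Lemma mem_topo k : k \in topo.
Proof. by rewrite mem_sort mem_enum. Qed.

Lemma topo_uniq : uniq topo.
Proof. by rewrite sort_uniq enum_uniq. Qed.

Definition before k : seq 'I_n := take (index k topo) topo.

Lemma mem_before j k : (j \in before k) = (index j topo < index k topo)%N.
Proof. exact/in_take/mem_topo. Qed.

Lemma connect_before j k : connect e j k -> j != k -> j \in before k.
Proof.
move=> jk j_k; rewrite mem_before ltnNge leq_eqVlt; apply/norP; split.
  apply: contra j_k => /eqP E; apply/eqP.
  by rewrite -(nth_index j (mem_topo j)) -E nth_index ?mem_topo.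
apply/negP => lt_kj; have := ancestors_lt jk j_k; rewrite ltnNge.
suff -> : (#|ancestors k| <= #|ancestors j|)%N by [].
apply: (@sorted_ltn_index _ (relpre (fun k => #|ancestors k|) leq) _ topo);
  rewrite ?mem_topo //.
  by move=> x y z /=; apply: leq_trans.
by apply: sort_sorted => x y; apply: leq_total.
Qed.

Lemma pa_before j k : j \in pa e k -> j \in before k.
Proof.
rewrite inE => jk; apply: connect_before; first exact: connect1.
by apply: contraTneq jk => ->; apply/negP => /(parentN_descendent forest); rewrite connect0.
Qed.

Lemma before_descendents j k : j \in before k -> j \notin descendents e k.
Proof.
move=> jk; rewrite inE; apply/negP => kj; have [E|j_k] := eqVneq k j.
  by rewrite E mem_before ltnn in jk.
have := connect_before kj j_k; move: jk; rewrite !mem_before; lia.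
Qed.

Lemma topo_split k : exists s, topo = before k ++ k :: s.
Proof.
exists (drop (index k topo).+1 topo).
rewrite -[LHS](cat_take_drop (index k topo)) (drop_nth k) ?index_mem ?mem_topo //.
by rewrite nth_index ?mem_topo.
Qed.

Lemma topo_before s1 k s2 : topo = s1 ++ k :: s2 -> before k = s1.
Proof.
move=> E; have := topo_uniq; rewrite E cat_uniq /= => /and3P[_ /norP[ks1 _] _].
by rewrite /before E index_cat (negbTE ks1) /= eqxx addn0 take_size_cat.
Qed.

End TopologicalOrder.

(** * Components after deletion of a separating set *)

Section Components.
Variables (n : nat) (e : rel 'I_n).
Hypothesis forest : directed_forest e.
Implicit Types (i j k : 'I_n) (A B C D : {set 'I_n}).

(** The side of [A] when [C] is removed.  Unlike [A], it can be left only
    through [C], and this makes the exchange of the coordinates on it compatible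
    with all edges. *)
Definition avoiding_component A C : {set 'I_n} :=
  [set i | [exists j in A, connect (fun x y => (e x y || e y x) && (y \notin C)) j i]]%SET.

Section Component.
Variables A B C : {set 'I_n}.
Hypothesis ABC : global_statements e (Indep A B C).
Let D := avoiding_component A C.

Lemma sub_component : A \subset D.
Proof.
by apply/fintype.subsetP => i iA; rewrite inE; apply/existsP; exists i; rewrite iA connect0.
Qed.

Lemma component_disjoint_given : [disjoint C & D]%B.
Proof.
case: ABC => _ AC _ _; rewrite disjoint_sym.
rewrite disjoint_subset; apply/fintype.subsetP => i; rewrite !inE.
move=> /existsP[j /andP[jA /connectP[p]]]; case/lastP: p => [_ -> /=|p w].
  by rewrite (disjointFr AC).
by rewrite rcons_path last_rcons => /andP[_ /andP[_ +]] ->.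
Qed.

(** Without colliders only a vertex of [C] can block a chain, and a chain
    inside the component avoids [C]. *)
Lemma component_disjoint_right : [disjoint B & D]%B.
Proof.
case: (ABC) => _ AC _ sep; rewrite disjoint_sym.
rewrite disjoint_subset; apply/fintype.subsetP => i; rewrite !inE.
move=> /existsP[j /andP[jA /connectP[p0 path_p0 i_def]]].
apply/negP; rewrite i_def; case/shortenP: path_p0 => p path_p up _ lB.
have pC z : z \in j :: p -> z \notin C.
  rewrite inE => /orP[/eqP->|]; first by rewrite (disjointFr AC).
  elim: (p) (j) path_p => //= w q IH x /andP[/andP[_ wC] wq].
  by rewrite inE => /orP[/eqP->//|]; exact: IH wq.
have ch : chain e (j :: p).
  by rewrite /chain up /=; apply: sub_path path_p => x y /andP[].
have [z zp] : blocked e C (j :: p) by apply: sep jA lB ch.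
case=> [[zC _]|[_ _]]; first by have := pC z zp; rewrite zC.
by rewrite (negbTE (forest_no_collider forest _ up)).
Qed.

Lemma component_boundary i j : e i j || e j i -> i \in D -> j \notin D -> j \in C.
Proof.
rewrite !inE => ij /existsP[w /andP[wA wi]]; apply: contraR => jC.
apply/existsP; exists w; rewrite wA (connect_trans wi) //.
by apply: connect1; rewrite ij jC.
Qed.

End Component.

End Components.

(** * Exchanging coordinates between states *)

Section States.
Variables (n : nat) (d : 'I_n -> nat).
Implicit Types (i j k : 'I_n) (A B C D : {set 'I_n}) (u v w : states d).

Definition swap D u v : states d :=
  [ffun i => if i \in D then v i else u i].

Lemma swapE D u v i : swap D u v i = if i \in D then v i else u i.
Proof. by rewrite ffunE. Qed.

Definition restr A u : values d A := [ffun i => u (val i)].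

Lemma agreesP A u (a : values d A) :
  reflect (forall (i : 'I_n) (iA : i \in A), u i = a (exist _ i iA)) (agrees u a).
Proof.
apply: (iffP forallP) => [H i iA|H [i iA]]; last by rewrite H.
exact/eqP/(H (exist _ i iA)).
Qed.

Lemma agrees_restr A u v : agrees u (restr A v) = [forall i in A, u i == v i].
Proof.
apply/agreesP/forall_inP => H i iA; first by rewrite (H i iA) ffunE.
by rewrite ffunE; apply/eqP/H.
Qed.

Lemma agrees_swap_in A D u v (a : values d A) : A \subset D ->
  agrees (swap D u v) a = agrees v a.
Proof.
move=> /fintype.subsetP AD.
by apply/agreesP/agreesP => H i iA; rewrite -H swapE AD.
Qed.

Lemma agrees_swap_out A D u v (a : values d A) : [disjoint A & D]%B ->
  agrees (swap D u v) a = agrees u a.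
Proof.
move=> AD.
by apply/agreesP/agreesP => H i iA; rewrite -H swapE (disjointFr AD).
Qed.

Definition digit_bound := (\max_i d i)%N.

Lemma state_digit u i : (u i < digit_bound)%N.
Proof. exact: leq_trans (ltn_ord _) (leq_bigmax i). Qed.

Definition state_code (s : seq 'I_n) u : nat :=
  code digit_bound s (fun i => nat_of_ord (u i)).

Lemma state_code_swap s D u v :
  (state_code s (swap D u v) + state_code s (swap D v u) =
   state_code s u + state_code s v)%N.
Proof. by apply: code_addn => i; rewrite !swapE; case: ifP => // _; apply: addnC. Qed.

End States.

Arguments agreesP {n d A u a}.

(** * Exchange binomials *)

Section Exchange.
Variables (R : realType) (n : nat) (d : 'I_n -> nat).
Implicit Types (A B C D : {set 'I_n}) (u v w : states d).

Definition agree_on A u v : bool := [forall i in A, u i == v i].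

(** When [A], [B] and [C] cover all vertices, only one state is summed. *)
Lemma marginal_unknown A B C u (a : values d A) (b : values d B) (c : values d C) :
  (A :|: B :|: C = [set: 'I_n])%SET ->
  [&& agrees u a, agrees u b & agrees u c] -> marginal R a b c = unknown R u.
Proof.
move=> cover /and3P[ua ub uc]; rewrite /marginal (big_pred1 u) // => v /=.
apply/idP/eqP => [|->]; last by rewrite ua ub uc.
case/and3P => va vb vc; apply/ffunP => i.
have : i \in (A :|: B :|: C)%SET by rewrite cover inE.
rewrite !inE -orbA => /or3P[] iX.
- by rewrite (elimT agreesP va _ iX) (elimT agreesP ua _ iX).
- by rewrite (elimT agreesP vb _ iX) (elimT agreesP ub _ iX).
- by rewrite (elimT agreesP vc _ iX) (elimT agreesP uc _ iX).
Qed.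

Lemma agrees_restr_id A u : agrees u (restr A u).
Proof. by rewrite agrees_restr; apply/forall_inP. Qed.

Lemma exchange_generator A B C u v :
  (A :|: B :|: C = [set: 'I_n])%SET ->
  [disjoint A & B]%B -> [disjoint A & C]%B -> agree_on C u v ->
  indep_ideal (Indep A B C) (unknown R u * unknown R v -
    unknown R (swap A u v) * unknown R (swap A v u)).
Proof.
move=> cover AB AC uv; have AA : A \subset A by [].
have BA : [disjoint B & A]%B by rewrite disjoint_sym.
have CA : [disjoint C & A]%B by rewrite disjoint_sym.
apply: sub_ideal_gen.
exists (restr A u), (restr A v), (restr B u), (restr B v), (restr C u).
have vu : agrees v (restr C u).
  by rewrite agrees_restr; apply/forall_inP => i iC; rewrite eq_sym (forall_inP uv).
rewrite (@marginal_unknown _ _ _ u) ?agrees_restr_id //.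
rewrite (@marginal_unknown _ _ _ v) ?agrees_restr_id ?vu //.
rewrite (@marginal_unknown _ _ _ (swap A v u)) //; last first.
  by rewrite agrees_swap_in // !agrees_swap_out // !agrees_restr_id vu.
rewrite (@marginal_unknown _ _ _ (swap A u v)) //; last first.
  by rewrite agrees_swap_in // !agrees_swap_out // !agrees_restr_id.
by rewrite [X in _ - X]mulrC.
Qed.

(** Exchanging the coordinates on [D] matches the pairs of states that are
    summed in the two products of a generator.  The side [D] may be larger than
    [A], which is what makes the lemma apply to statements that do not involve
    all vertices. *)
Lemma exchange_rmorph0 (Q : comNzRingType)
    (phi : {rmorphism {mpoly R[#|{: states d}|]} -> Q}) A B C D :
  A \subset D -> [disjoint B & D]%B -> [disjoint C & D]%B ->
  (forall u v, agree_on C u v ->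
    phi (unknown R (swap D u v)) * phi (unknown R (swap D v u)) =
    phi (unknown R u) * phi (unknown R v)) ->
  forall f, indep_ideal (Indep A B C) f -> phi f = 0.
Proof.
move=> AD BD CD phi_swap; apply: ideal_gen_rmorph0 => g.
case=> a [a' [b [b' [c ->]]]].
apply/eqP; rewrite rmorphB subr_eq0 !rmorphM /= /marginal !rmorph_sum /=.
rewrite !big_distrlr !pair_big /=; apply/eqP.
(* The factors change places so that the first state agrees with [a]. *)
pose h (x : states d * states d) := (swap D x.2 x.1, swap D x.1 x.2).
have hK : involutive h.
  case=> u v; rewrite /h /=.
  by congr pair; apply/ffunP => i; rewrite !swapE; case: (i \in D).
rewrite [RHS](reindex_inj (inv_inj hK)) /=; apply: eq_big => -[u v] /=.
  rewrite !(agrees_swap_in _ _ _ AD) !(agrees_swap_out _ _ _ BD).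
  rewrite !(agrees_swap_out _ _ _ CD).
  by do !case: (agrees _ _).
move=> /andP[/and3P[_ _ uc] /and3P[_ _ vc]].
rewrite [RHS]mulrC phi_swap //; apply/forall_inP => i iC.
by apply/eqP; rewrite (elimT agreesP uc _ iC) (elimT agreesP vc).
Qed.

End Exchange.

(** * The global ideal of a forest *)

Section ForestIdeal.
Variables (R : realType) (n : nat) (d : 'I_n -> nat) (e : rel 'I_n).
Hypothesis forest : directed_forest e.
Implicit Types (i j k : 'I_n) (A B C D : {set 'I_n}) (u v w : states d).

(** A vertex with its parents.  The empty family [None] makes the toric map
    record the degree of a monomial even if there are no vertices. *)
Definition family (o : option 'I_n) : {set 'I_n} :=
  if o is Some k then (k |: pa e k)%SET else finset.set0.

(** A parameter is a family with values for it.  The values are given as the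
    restriction of a full state, which avoids dependent tuples at the price of
    many parameters that describe the same values. *)
Definition parameter : finType := (option 'I_n * states d)%type.

Definition state_mnm u : 'X_{1..#|{: parameter}|} :=
  [multinom (agree_on (family (enum_val x).1) u (enum_val x).2 : nat)
     | x < #|{: parameter}|].

Lemma state_mnmE u (x : parameter) :
  state_mnm u (enum_rank x) = agree_on (family x.1) u x.2 :> nat.
Proof. by rewrite mnmE enum_rankK. Qed.

(** If the two states agree on one part of each family, exchanging the
    coordinates on [D] either fixes or permutes their restrictions to it. *)
Lemma state_mnm_swap D u v :
  (forall o, {in family o :&: D, forall i, u i = v i} \/
             {in family o :\: D, forall i, u i = v i}) ->
  (state_mnm (swap D u v) + state_mnm (swap D v u) =
   state_mnm u + state_mnm v)%MM.
Proof.
move=> uv; apply/mnmP => x0; rewrite !mnmDE -(enum_valK x0).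
case: (enum_val x0) => o w; rewrite !state_mnmE /=.
have same (u1 u2 : states d) : {in family o, forall i, u1 i = u2 i} ->
    agree_on (family o) u1 w = agree_on (family o) u2 w.
  by move=> E; apply: eq_forallb_in => i io; rewrite E.
case: (uv o) => E; last rewrite addnC.
  congr (_ + _)%N; congr nat_of_bool; apply: same => i io; rewrite swapE;
    case: ifP => // iD; rewrite E // inE io iD //.
congr (_ + _)%N; congr nat_of_bool; apply: same => i io; rewrite swapE;
  case: ifPn => // iD; rewrite E // inE io iD //.
Qed.

Let S (x : 'I_#|{: states d}|) := state_mnm (enum_val x).

Lemma toric_unknown u :
  toric_map S (unknown R u) = 'X_[state_mnm u] :> {mpoly R[_]}.
Proof. by rewrite /unknown toric_mapX mnm_image1 /S enum_rankK. Qed.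

(** A family is a vertex with at most one parent, hence is cut by [D] along at
    most one edge, and the end of this edge outside [D] lies in [C]. *)
Lemma family_split A C o (D := avoiding_component e A C) :
  {in family o :&: D, forall i, i \in C} \/ {in family o :\: D, forall i, i \in C}.
Proof.
case: o => [k|]; last by left => i; rewrite !inE.
have [kD|kD] := boolP (k \in D).
  right => i; rewrite finset.in_setD finset.in_setU1 in_pa.
  move=> /andP[iD /orP[/eqP E|ik]].
    by rewrite E kD in iD.
  by apply: component_boundary kD iD; rewrite ik orbT.
have [/existsP[j /andP[jk jD]]|noj] := boolP [exists j, e j k && (j \in D)].
  right => i; rewrite finset.in_setD finset.in_setU1 in_pa.
  move=> /andP[iD /orP[/eqP->|ik]].
    by apply: component_boundary jD kD; rewrite jk.
  by rewrite (parent_uniq forest ik jk) jD in iD.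
left => i; rewrite finset.in_setI finset.in_setU1 in_pa => /andP[/orP[/eqP->|ik] iD].
  by rewrite iD in kD.
by case/negP: noj; apply/existsP; exists i; rewrite ik.
Qed.

Definition global_generator (f : {mpoly R[#|{: states d}|]}) : Prop :=
  exists2 s, global_statements e s & indep_ideal s f.

Lemma toric_global f : global_generator f -> toric_map S f = 0.
Proof.
case=> -[A B C] ABC; pose D := avoiding_component e A C.
apply: (exchange_rmorph0 (phi := toric_map S) (D := D)).
- by apply: sub_component.
- by apply: component_disjoint_right ABC.
- by apply: component_disjoint_given ABC.
- move=> u v /forall_inP uv /=; rewrite !toric_unknown -!mpolyXD.
  rewrite state_mnm_swap // => o.
  by case: (family_split A C o) => oC; [left|right] => i /oC /uv /eqP.
Qed.

(** The order called sorted is the decreasing one: exchanging the coordinates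
    of an increasing pair brings the two codes closer together, and this lowers
    a convex weight. *)
Definition unsorted k u v : bool :=
  [&& agree_on (pa e k) u v,
      (state_code (before e k) u < state_code (before e k) v)%N & (u k < v k)%N].

Definition state_rank (u : states d) : 'I_#|{: states d}| := enum_rank u.

Definition subtree_move (x : 'I_n * (states d * states d)) :=
  let: (k, (u, v)) := x in
  ((state_rank u, state_rank v),
   (state_rank (swap (descendents e k) u v),
    state_rank (swap (descendents e k) v u))).

Definition moves :=
  [seq subtree_move x | x <- enum {: 'I_n * (states d * states d)} &
     unsorted x.1 x.2.1 x.2.2].

Lemma movesP y : reflect
  (exists k u v, unsorted k u v /\ y = subtree_move (k, (u, v))) (y \in moves).
Proof.
apply: (iffP mapP) => [[[k [u v]]]|[k [u [v [kuv ->]]]]].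
  by rewrite mem_filter => /andP[kuv _] ->; exists k, u, v.
by exists (k, (u, v)); rewrite // mem_filter kuv mem_enum.
Qed.

Lemma move_global y : y \in moves -> ideal_gen global_generator (move_binomial R y).
Proof.
case/movesP => k [u [v [/and3P[uv _ _] ->]]].
have ABC := descendents_separated forest k; have [AB AC _ _] := ABC.
apply: sub_ideal_gen; exists (Indep (descendents e k) (nd e k) (pa e k)) => //.
rewrite /move_binomial /pair_mnm /= !mpolyXD.
exact: exchange_generator (descendents_cover e k) AB AC uv.
Qed.

(** Any strictly convex function of the code would do as a weight. *)
Definition state_weight (x : 'I_#|{: states d}|) : nat :=
  (state_code (topo e) (enum_val x) ^ 2)%N.

(** Of the code only the digits of [k] and later vertices change.  The digit of
    [k] increases in the smaller state, which remains below the larger one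
    because the digits before [k] still decide the comparison. *)
Lemma moves_lower_weight y : y \in moves ->
  (mnm_weight state_weight (pair_mnm y.2) < mnm_weight state_weight (pair_mnm y.1))%N.
Proof.
case/movesP => k [u [v [/and3P[_ lt_uv ukvk] ->]]] /=.
rewrite !mnm_weightD !mnm_weight1 /state_weight /= !enum_rankK.
set D := descendents e k; set u' := swap D u v; set v' := swap D v u.
have [s topoE] := topo_split e k.
have sum : (state_code (topo e) u' + state_code (topo e) v' =
  state_code (topo e) u + state_code (topo e) v)%N by apply: state_code_swap.
have pre_u' : state_code (before e k) u' = state_code (before e k) u.
  apply: eq_code => i /(before_descendents forest) iD.
  by rewrite swapE (negbTE iD).
have lt1 : (state_code (topo e) u < state_code (topo e) u')%N.
  rewrite topoE -cat_rcons; apply: ltn_code_cat => [i|]; first exact: state_digit.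
  rewrite !code_rcons [code _ _ _ in ltnRHS]pre_u' ltn_add2l swapE.
  by rewrite /D inE connect0.
have lt2 : (state_code (topo e) u' < state_code (topo e) v)%N.
  rewrite topoE; apply: ltn_code_cat => [i|]; first exact: state_digit.
  by rewrite [ltnLHS]pre_u'.
nia.
Qed.

Lemma irreducible_antisorted m k w : irreducible moves m ->
  antisorted (state_code (before e k)) (fun u => nat_of_ord (u k))
    (fun u => m (state_rank u)) (fun u => agree_on (pa e k) u w).
Proof.
move=> irr u v mu mv uw vw lt_uv; rewrite leqNgt; apply/negP => ukvk.
have kuv : unsorted k u v.
  apply/and3P; split=> //; apply/forall_inP => i ik.
  by rewrite (eqP (forall_inP uw i ik)) eq_sym (forall_inP vw).
have /movesP/irr/negP : exists k' u' v', unsorted k' u' v' /\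
    subtree_move (k, (u, v)) = subtree_move (k', (u', v')) by exists k, u, v.
apply; apply/mnm_lepP => x; rewrite mnmDE !mnm1E /=.
have uv : state_rank u != state_rank v.
  by apply: contraTneq lt_uv => /enum_rank_inj ->; rewrite ltnn.
case: (eqVneq (state_rank u) x) uv => [<-|_ _].
  by rewrite eq_sym => /negbTE->.
by case: eqVneq => [<-|].
Qed.


Lemma mnm_image_mass (m : 'X_{1..#|{: states d}|}) o w :
  mnm_image S m (enum_rank ((o, w) : parameter)) =
  mass (fun u => m (state_rank u)) (fun u => agree_on (family o) u w).
Proof.
rewrite /mnm_image mnm_sumE (reindex (@enum_rank (states d))) /=; last first.
  by apply: onW_bij; apply: enum_rank_bij.
rewrite /mass [RHS]big_mkcond; apply: eq_bigr => u _.
rewrite mulmnE /S enum_rankK state_mnmE /=.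
by case: agree_on; rewrite ?mul1n ?mul0n.
Qed.

(** The values at the parents, as an element of a type that does not depend on
    [k]; 0 is a filler at the other vertices. *)
Definition pa_states k u : {ffun 'I_n -> nat} :=
  [ffun i => if i \in pa e k then nat_of_ord (u i) else 0%N].

Lemma pa_statesE k u v : (pa_states k u == pa_states k v) = agree_on (pa e k) u v.
Proof.
apply/eqP/forall_inP => [/ffunP E i ik|E].
  by have := E i; rewrite !ffunE ik => /ord_inj ->.
by apply/ffunP => i; rewrite !ffunE; case: ifP => // ik; rewrite (eqP (E i ik)).
Qed.

(** Induction along the topological order: the distribution of the coordinates
    before [k] is known, and that of [k] with its parent is recorded by the
    toric map, so [antisorted_unique] gives the joint distribution. *)
Lemma irreducible_moves_inj m1 m2 : irreducible moves m1 -> irreducible moves m2 ->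
  mnm_image S m1 = mnm_image S m2 -> m1 = m2.
Proof.
move=> irr1 irr2 im.
pose mu (m : 'X_{1..#|{: states d}|}) u := m (state_rank u).
have Emass o w : mass (mu m1) (fun u => agree_on (family o) u w) =
                 mass (mu m2) (fun u => agree_on (family o) u w).
  by rewrite -!mnm_image_mass im.
suff prefix s1 s2 : topo e = s1 ++ s2 -> forall v,
    mass (mu m1) (fun u => state_code s1 u == state_code s1 v) =
    mass (mu m2) (fun u => state_code s1 u == state_code s1 v).
  apply/mnmP => x; rewrite -(enum_valK x); set v := enum_val x.
  have sep u : (state_code (topo e) u == state_code (topo e) v) = (u == v).
    apply/eqP/eqP => [E|-> //]; apply/ffunP => i; apply: ord_inj.
    exact: (code_inj (state_digit u) (state_digit v) E (mem_topo e i)).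
  have := prefix _ _ (esym (cats0 _)) v.
  by rewrite !(eq_mass _ sep) /mass !(big_pred1 v) // /mu /state_rank.
elim/last_ind: s1 s2 => [|s1 k IH] s2 s_def v.
  have E u : (state_code [::] u == state_code [::] v) = agree_on (family None) u v.
    by rewrite /= eqxx; apply/esym/forall_inP => i; rewrite inE.
  by rewrite !(eq_mass _ E).
rewrite cat_rcons in s_def; have before_k := topo_before s_def.
have E u : (state_code (rcons s1 k) u == state_code (rcons s1 k) v) =
    (state_code s1 u == state_code s1 v) && (nat_of_ord (u k) == nat_of_ord (v k)).
  by apply: code_rcons_eq; apply: state_digit.
rewrite !(eq_mass _ E) -before_k.
have anti m : irreducible moves m -> forall c, antisorted
    (state_code (before e k)) (fun u => nat_of_ord (u k)) (mu m)
    (fun u => pa_states k u == c).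
  move=> irr c u w mu_u mu_w /eqP uc /eqP wc.
  by apply: (irreducible_antisorted (w := u) irr mu_u mu_w);
    rewrite -pa_statesE ?uc ?wc.
apply: (antisorted_unique (cls := pa_states k)) => //.
- move=> u w /code_inj E1; apply/eqP; rewrite pa_statesE; apply/forall_inP => i ik.
  apply/eqP/ord_inj.
  exact: (E1 (state_digit u) (state_digit w) i (pa_before forest ik)).
- exact: anti.
- exact: anti.
- by move=> w; rewrite before_k; apply: IH s_def w.
- move=> w.
  have E2 u : ((pa_states k u, nat_of_ord (u k)) == (pa_states k w, nat_of_ord (w k)))
      = agree_on (family (Some k)) u w.
    rewrite xpair_eqE pa_statesE; apply/andP/forall_inP => [[/forall_inP H uk] i|H].
      by rewrite finset.in_setU1 => /orP[/eqP->|/H].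
    split; last by apply: H; rewrite finset.in_setU1 eqxx.
    by apply/forall_inP => i ik; apply: H; rewrite finset.in_setU1 ik orbT.
  by rewrite !(eq_mass _ E2).
Qed.

Lemma forest_global : prime_ideal (I_global R d e) /\
  has_quadratic_groebner_basis (I_global R d e).
Proof.
split.
  apply: (toric_prime toric_global move_global moves_lower_weight).
  exact: irreducible_moves_inj.
apply: (toric_groebner toric_global move_global moves_lower_weight).
exact: irreducible_moves_inj.
Qed.

End ForestIdeal.

(** * A local ideal that is not prime *)

Section Chain4.
Variable R : realType.

Definition chain4 : rel 'I_4 := fun i j => j == i.+1 :> nat.

(** The single level at vertex 1 makes the statement at vertex 2 unconditional
    and leaves eight unknowns. *)
Definition levels4 (i : 'I_4) : nat := (i != 1%N :> nat).+1.

Lemma connect_chain4 i j : connect chain4 i j = (i <= j)%N.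
Proof.
apply/idP/idP => [/connectP[p + ->]|].
  elim: p i => //= k p IH i /andP[/eqP ik /IH]; apply: leq_trans.
  by rewrite ik.
elim: {j}(j : nat) {-2}j (erefl (j : nat)) => [|m IH] j jm.
  by rewrite jm leqn0 => /eqP i0; rewrite (_ : j = i) ?connect0 //; apply: ord_inj; lia.
rewrite leq_eqVlt => /orP[/eqP/ord_inj->|lt_ij]; first exact: connect0.
have m4 : (m < 4)%N by have := ltn_ord j; lia.
apply: (connect_trans (y := Ordinal m4)); first by apply: IH => //=; lia.
by apply: connect1; rewrite /chain4 /= jm.
Qed.

Lemma chain4_forest : directed_forest chain4.
Proof.
split=> [i j /eqP ij|i]; first by rewrite connect_chain4; lia.
apply/card_le1_eqP => j k; rewrite !inE /chain4 => /eqP ij /eqP ik.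
by apply: ord_inj; lia.
Qed.

Local Notation o0 := (@Ordinal 4 0 isT).
Local Notation o1 := (@Ordinal 4 1 isT).
Local Notation o2 := (@Ordinal 4 2 isT).
Local Notation o3 := (@Ordinal 4 3 isT).

Lemma ord4P (i : 'I_4) : [\/ i = o0, i = o1, i = o2 | i = o3].
Proof.
case: i => [[|[|[|[|m]]]] lt_i4] //; [apply: Or41|apply: Or42|apply: Or43|apply: Or44];
  exact: ord_inj.
Qed.

(** The values at the vertices 0, 2 and 3; vertex 1 has only one value. *)
Definition state4 (a c x : bool) : states levels4 :=
  [ffun i : 'I_4 => inord (nth 0%N [:: a : nat; 0%N; c : nat; x : nat] i)].

Lemma state4E a c x i :
  state4 a c x i = nth 0%N [:: a : nat; 0%N; c : nat; x : nat] i :> nat.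
Proof.
rewrite ffunE inordK //.
by case: (ord4P i) => ->; case: a c x => [] [] [].
Qed.

Lemma state4_eq (w : states levels4) (a c x : bool) :
  w o0 = a :> nat -> w o2 = c :> nat -> w o3 = x :> nat -> w = state4 a c x.
Proof.
move=> w0 w2 w3; apply/ffunP => i; apply: ord_inj; rewrite state4E.
by case: (ord4P i) => -> //=; case: (w o1) => -[].
Qed.

Lemma state4_swap a c x a' c' x' :
  swap [set o3] (state4 a c x) (state4 a' c' x') = state4 a c x'.
Proof. by apply: state4_eq; rewrite swapE inE /= state4E. Qed.

Local Notation X a c x := (unknown R (state4 a c x)).
Local Notation I := (I_local R levels4 chain4).

Lemma local_chain4 i f :
  indep_ideal (Indep [set i] (nd chain4 i) (pa chain4 i)) f -> I f.
Proof.
move=> fi; apply: sub_ideal_gen.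
by exists (Indep [set i] (nd chain4 i) (pa chain4 i)) => //; exists i.
Qed.

(** The statement at vertex 3: given vertex 2, it is independent of vertex 0. *)
Lemma local_last c :
  I (X false c false * X true c true - X false c true * X true c false).
Proof.
apply: (local_chain4 (i := o3)).
rewrite -(state4_swap false c false true c true) -(state4_swap true c true false c false).
have cover : descendents chain4 o3 = [set o3]%SET.
  by apply/setP => j; rewrite !inE connect_chain4; case: (ord4P j) => ->.
apply: exchange_generator.
- by rewrite -cover descendents_cover.
- by rewrite disjoints1 inE eqxx.
- by rewrite disjoints1 inE.
- apply/forall_inP => j; rewrite inE => /eqP ij; apply/eqP/ord_inj.
  rewrite !state4E; case: (ord4P j) ij => -> //.
Qed.

Lemma last_notin i : i != o3 ->
  [/\ o3 \notin [set i]%SET, o3 \notin nd chain4 i & o3 \notin pa chain4 i].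
Proof.
move=> i3; rewrite !inE eq_sym i3 connect_chain4 /chain4.
by case: (ord4P i) i3 => ->.
Qed.

(** The statement at vertex 2: it is independent of vertex 0.  The sums run
    over the values of vertex 3, which does not occur in the statement. *)
Lemma local_middle :
  I ((X false false false + X false false true) * (X true true false + X true true true)
   - (X false true false + X false true true) * (X true false false + X true false true)).
Proof.
apply: (local_chain4 (i := o2)); apply: sub_ideal_gen.
pose val2 A a c : values levels4 A := restr A (state4 a c false).
have margE a c c0 a0 a1 c1 : marginal R (val2 [set o2]%SET a0 c)
    (val2 (nd chain4 o2) a c0) (val2 (pa chain4 o2) a1 c1) = X a c false + X a c true.
  have agree2 A (w : states levels4) a' c' : agrees w (val2 A a' c') =
      [forall i in A, w i == state4 a' c' false i] by apply: agrees_restr.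
  have nd2 j : (j \in nd chain4 o2) = (j == o0).
    by rewrite !inE connect_chain4 /chain4; case: (ord4P j) => ->.
  have pa2 j : (j \in pa chain4 o2) = (j == o1).
    by rewrite !inE /chain4; case: (ord4P j) => ->.
  have allE (A : {set 'I_4}) (j : 'I_4) (w : states levels4) a' c' :
      (forall k, (k \in A) = (k == j)) ->
      agrees w (val2 A a' c') = (w j == state4 a' c' false j :> nat).
    move=> Aj; rewrite agree2; apply/forall_inP/idP => [H|/eqP wj k].
      by rewrite (eqP (H j _)) ?Aj.
    by rewrite Aj => /eqP->; apply/eqP/ord_inj.
  rewrite /marginal (eq_bigl (fun w : states levels4 =>
    (w == state4 a c false) || (w == state4 a c true))) => [|w]; last first.
    rewrite (allE [set o2]%SET o2) => [|k]; last by rewrite inE.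
    rewrite (allE (nd chain4 o2) o0) // (allE (pa chain4 o2) o1) //.
    rewrite !state4E /=; apply/and3P/orP => [[/eqP w2 /eqP w0 _]|]; last first.
      by case=> /eqP ->; split; rewrite ?state4E.
    have : (w o3 < 2)%N by exact: (ltn_ord (w o3)).
    case w3: (nat_of_ord (w o3)) => [|[|//]] _; [left|right]; apply/eqP;
      exact: state4_eq.
  rewrite (bigD1 (state4 a c false)) ?eqxx //=; congr (_ + _).
  apply: big_pred1 => w /=; have [->|_] := eqVneq w (state4 a c true).
    rewrite orbT /=; apply/eqP => /ffunP /(_ o3) /(congr1 (@nat_of_ord _)).
    by rewrite !state4E.
  by rewrite orbF andbN.
exists (val2 _ false false), (val2 _ false true).
exists (val2 _ false false), (val2 _ true false), (val2 _ false false).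
by rewrite !margE [Y in _ - Y]mulrC.
Qed.

(** The names [x], [y] stand for the values 0, 1 at vertex 2, the index for the
    value at vertex 0, and primes for the value 1 at vertex 3.  The global Markov
    property would make vertex 0 independent of the pair (2, 3), so that
    [x0 * y1 = y0 * x1]; multiplying by the marginals [x0 + x0'] and [y0 + y0']
    is how the contraction axiom derives this from the local statements. *)
Lemma chain4_identity (Q : comNzRingType) (x0 x0' x1 x1' y0 y0' y1 y1' : Q) :
  (x0 + x0') * ((y0 + y0') * (x0 * y1 - y0 * x1)) =
  x0 * y0 * ((x0 + x0') * (y1 + y1') - (y0 + y0') * (x1 + x1'))
  + (y0 * (y0 + y0')) * (x0 * x1' - x0' * x1)
  + (- (x0 * (x0 + x0'))) * (y0 * y1' - y0' * y1).
Proof. ring. Qed.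

Lemma local_ones f : I f -> f.@[fun=> 1] = 0.
Proof.
apply: (ideal_gen_rmorph0 (phi := meval (fun=> 1))) => g [_ [i ->]].
apply: (exchange_rmorph0 (phi := meval (fun=> 1)) (D := [set i]%SET)).
- by [].
- by rewrite disjoint_sym disjoints1 inE eqxx.
- by rewrite disjoint_sym disjoints1 inE /chain4; lia.
- by move=> u v _; rewrite /unknown /= !mevalXU.
Qed.

(** A zero of the local ideal outside the zero set of the global one: the
    marginals that sum over vertex 3 vanish, so that only the statement at this
    vertex is a constraint, and the values at 0 and 2 may depend on each
    other. *)
Definition signed_point (w : states levels4) : R :=
  if w o0 == w o2 :> nat then (-1) ^+ w o3 else 0.

Definition flip_last (w : states levels4) : states levels4 :=
  [ffun i => if i == o3 then rev_ord (w i) else w i].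

Lemma local_signed f : I f -> f.@[fun x => signed_point (enum_val x)] = 0.
Proof.
pose phi : {rmorphism {mpoly R[#|{: states levels4}|]} -> R} :=
  meval (fun x => signed_point (enum_val x)).
have phiX u : phi (unknown R u) = signed_point u.
  by rewrite [LHS]mevalXU enum_rankK.
move: f; apply: (ideal_gen_rmorph0 (phi := phi)) => g [_ [i ->]].
have [->|i3] := eqVneq i o3.
  apply: (exchange_rmorph0 (phi := phi) (D := [set o3]%SET)).
  - by [].
  - by rewrite disjoint_sym disjoints1 inE eqxx.
  - by rewrite disjoint_sym disjoints1 inE.
  - move=> u v _; rewrite !phiX /signed_point !swapE !inE /=.
    by do 2!case: ifP => _; rewrite ?mul0r ?mulr0 // mulrC.
have [n1 n2 n3] := last_notin i3.
apply: ideal_gen_rmorph0 => h [a [a' [b [b' [c ->]]]]].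
suff marg0 (a0 : values levels4 [set i]%SET) (b0 : values levels4 (nd chain4 i))
    (c0 : values levels4 (pa chain4 i)) : phi (marginal R a0 b0 c0) = 0.
  by rewrite rmorphB !rmorphM /= !marg0 !mul0r subrr.
have flipE w j : flip_last w j = if j == o3 then rev_ord (w j) else w j.
  by rewrite ffunE.
have flipK : involutive flip_last.
  by move=> w; apply/ffunP => j; rewrite !flipE; case: (j == o3); rewrite ?rev_ordK.
have flip_agrees A (t : values levels4 A) w : o3 \notin A ->
    agrees (flip_last w) t = agrees w t.
  move=> A3; have E j : j \in A -> flip_last w j = w j.
    by move=> jA; rewrite flipE; case: eqP jA A3 => // -> ->.
  by apply/agreesP/agreesP => H j jA; rewrite -H E.
have sgn w : signed_point (flip_last w) = - signed_point w.
  rewrite /signed_point !flipE /=; case: ifP => _; last by rewrite oppr0.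
  have := ltn_ord (w o3); rewrite {1}/levels4 /= => w3.
  have -> : (levels4 o3 - (w o3).+1 = 1 - w o3)%N by [].
  by case: (nat_of_ord (w o3)) w3 => [|[|]] // _; rewrite ?expr0 ?expr1 ?opprK.
suff : phi (marginal R a0 b0 c0) = - phi (marginal R a0 b0 c0) by lra.
rewrite {1}/marginal (reindex_inj (inv_inj flipK)) /= !rmorph_sum /= -sumrN.
apply: eq_big => [w|w _]; first by rewrite !flip_agrees.
by rewrite !phiX sgn.
Qed.

Lemma chain4_not_prime : ~ prime_ideal I.
Proof.
case=> _ prime.
have memE f : (f \in [pred f | f \in I]) = (f \in I) by rewrite inE.
have step f g : I (f * g) -> I f \/ I g.
  move=> fg; have /prime : f * g \in [pred f | f \in I].
    by rewrite memE; apply: mem_set.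
  by rewrite !memE => /orP[/set_mem|/set_mem]; [left|right].
have : I ((X false false false + X false false true) *
   ((X false true false + X false true true) *
    (X false false false * X true true false - X false true false * X true false false))).
  rewrite (chain4_identity _ _ _ (X true false true) _ _ _ (X true true true)).
  apply: ideal_genD; first apply: ideal_genD; apply: ideal_genMl.
  - exact: local_middle.
  - exact: local_last.
  - exact: local_last.
case/step => [/local_ones|/step[/local_ones|/local_signed]].
- by rewrite mevalD !mevalXU => /eqP; rewrite -mulr2n pnatr_eq0.
- by rewrite mevalD !mevalXU => /eqP; rewrite -mulr2n pnatr_eq0.
- rewrite mevalB !mevalM !mevalXU !enum_rankK /signed_point !state4E /=.
  by rewrite mul0r subr0 expr0 mul1r => /eqP; rewrite oner_eq0.
Qed.

End Chain4.

Theorem theorem6 (R : realType) :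
  (forall (n : nat) (d : 'I_n -> nat) (e : rel 'I_n),
      (forall i, 0 < d i)%N -> directed_forest e ->
      prime_ideal (I_global R d e) /\
      has_quadratic_groebner_basis (I_global R d e)) /\
  (exists (n : nat) (d : 'I_n -> nat) (e : rel 'I_n),
      [/\ (forall i, 0 < d i)%N, directed_forest e &
      ~ (prime_ideal (I_local R d e) /\
         has_quadratic_groebner_basis (I_local R d e))]).
Proof.
split=> [n d e _ forest|]; first exact: forest_global.
exists 4%N, levels4, chain4; split => //; first exact: chain4_forest.
by case=> /chain4_not_prime.
Qed.
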